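(* Let $n\ge 1$ and $0\le p\le n-1$. The set $\mathcal{D}_p$ of permutations of $[n]$ at distance exactly $p$ from the identity (i.e., obtainable from $12\cdots n$ by $p$ right-jumps but not by fewer) is exactly the set of permutations of $[n]$ having exactly $p$ non-left-to-right-maxima. Consequently, the number $d_{n,p}$ of such permutations equals the signless Stirling number of the first kind $s(n,n-p)$ (the number of permutations of $[n]$ with exactly $n-p$ cycles), and $$d_{n,p}=\sum_{0\le j\le h\le p}(-1)^j\binom{h}{j}\binom{n-1+h}{p+h}\binom{n+p}{p-h}\frac{(j-h)^{p+h}}{h!}.$$
   Context: Permutations of $[n]=\{1,\dots,n\}$ are written as words $\sigma=\sigma_1\sigma_2\cdots\sigma_n$. A right-jump transforms $\sigma$ into $\sigma_1\cdots\sigma_{i-1}\sigma_{i+1}\cdots\sigma_j\sigma_i\sigma_{j+1}\cdots\sigma_n$ for some $1\le i<j\le n$. A left-to-right maximum of $\sigma$ is an entry $\sigma_i$ such that $\sigma_k<\sigma_i$ for all $k<i$; every other entry is called a non-left-to-right-maximum. *)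

(* Defs.v *)
From HB Require Import structures.
From mathcomp Require Import all_boot all_order all_algebra all_fingroup.
Set Implicit Arguments. Unset Strict Implicit. Unset Printing Implicit Defensive.

(* Permutations of [n] = {1..n} are words: sequences s with perm_eq s (iota 1 n).
   Positions are 0-indexed internally: the paper's sigma_i is nth 0 s (i-1). *)

(* Right-jump (0-indexed positions i < j < size s): move the entry at position i
   to just after the entry originally at position j. *)
Definition right_jump (s : seq nat) (i j : nat) : seq nat :=
  take i s ++ take (j - i) (drop i.+1 s) ++ [:: nth 0 s i] ++ drop j.+1 s.

Definition jumps (s : seq nat) : seq (seq nat) :=
  [seq right_jump s i j | i <- iota 0 (size s), j <- iota i.+1 (size s - i.+1)].

Fixpoint reachset (n k : nat) : seq (seq nat) :=
  if k is k'.+1 then flatten (map jumps (reachset n k')) else [:: iota 1 n].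

Definition reach (n k : nat) (s : seq nat) : bool := s \in reachset n k.

Definition dist_eq (n p : nat) (s : seq nat) : bool :=
  reach n p s && all (fun q => ~~ reach n q s) (iota 0 p).

Definition is_lrmax (s : seq nat) (i : nat) : bool :=
  all (fun k => nth 0 s k < nth 0 s i) (iota 0 i).
Definition nlrmax (s : seq nat) : nat :=
  count (fun i => ~~ is_lrmax s i) (iota 0 (size s)).

Definition dnp (n p : nat) : nat := count (dist_eq n p) (permutations (iota 1 n)).

Definition stirling1 (n k : nat) : nat := #|[set s : 'S_n | #|porbits s| == k]|.

Import GRing.Theory.
Local Open Scope ring_scope.

Definition dnp_formula (n p : nat) : rat :=
  \sum_(h < p.+1) \sum_(j < h.+1)
     (-1) ^+ j * ('C(h, j))%:R * ('C(n.-1 + h, p + h))%:R * ('C(n + p, p - h))%:R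
     * ((j%:Z - h%:Z)%:~R ^+ (p + h)) / (h`!)%:R.

(* Main.v *)
Require Import Defs.
From HB Require Import structures.
From mathcomp Require Import all_boot all_order all_algebra all_fingroup.
From mathcomp Require Import zify ring.

(* A right-jump can only demote the entry it moves, so it raises the number of
   non-records by at most one; conversely any non-record can be promoted by
   undoing a right-jump.

   Inserting the smallest letter, respectively adjoining a fixed point and
   multiplying by a transposition, shows that permutations counted by
   non-records and by cycles obey the same recurrence.

   For fixed p, c(n, n - p) = F(-n) and S(p + h, h) = F(h) for one polynomial F
   of degree at most 2p, and F(-1) = ... = F(-p) = 0 when p > 0.  The closed
   formula (Schlomilch's) is Lagrange interpolation of F at -p, ..., p,
   evaluated at -n. *)

Set Implicit Arguments. Unset Strict Implicit. Unset Printing Implicit Defensive.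

(** * Right-jumps and non-records *)

(** The accumulator is the running maximum, so the count splits over concatenations, which the
    positional [nlrmax] does not do directly. *)
Fixpoint nonrecords (m : nat) (s : seq nat) : nat :=
  if s is x :: s' then (x <= m) + nonrecords (maxn m x) s' else 0.

Lemma nonrecords_cat m s t :
  nonrecords m (s ++ t) = nonrecords m s + nonrecords (foldl maxn m s) t.
Proof. by elim: s m => //= x s IHs m; rewrite IHs addnA. Qed.

Lemma leq_foldl_maxn x m s : (x <= foldl maxn m s) = (x <= m) || has (leq x) s.
Proof. by elim: s m => [|y s IHs] m /=; rewrite ?orbF // IHs leq_max orbA. Qed.

Lemma nonrecords_mono m m' s : m <= m' -> nonrecords m s <= nonrecords m' s.
Proof.
elim: s m m' => //= x s IHs m m' le_mm'; apply: leq_add; last by apply: IHs; lia.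
by case: (leqP x m) => // /leq_trans/(_ le_mm') ->.
Qed.

Lemma nlrmax_rcons s x :
  nlrmax (rcons s x) = nlrmax s + ~~ all (fun y => y < x) s.
Proof.
rewrite /nlrmax size_rcons -addn1 iotaD count_cat /= addn0; congr (_ + _).
  apply: eq_in_count => i; rewrite mem_iota => /andP[_ lt_is] /=.
  congr negb; apply: eq_in_all => k; rewrite mem_iota => /andP[_ lt_ki] /=.
  by rewrite !nth_rcons lt_is (ltn_trans lt_ki lt_is).
rewrite /is_lrmax !nth_rcons ltnn eqxx; congr (nat_of_bool (~~ _)).
apply/allP/(all_nthP 0) => [lt_x i lt_is | lt_x i].
  by have := lt_x i; rewrite mem_iota nth_rcons lt_is; apply.
by rewrite mem_iota nth_rcons => /andP[_ lt_is]; rewrite ifT //; apply: lt_x.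
Qed.

(* Entries are positive, so the initial bound 0 never demotes a first entry. *)
Lemma nlrmaxE s : all (leq 1) s -> nlrmax s = nonrecords 0 s.
Proof.
elim/last_ind: s => // s x IHs; rewrite all_rcons => /andP[x_gt0 /IHs IH].
rewrite nlrmax_rcons IH -cats1 nonrecords_cat /= addn0 leq_foldl_maxn.
rewrite leqNgt x_gt0 /= -has_predC; congr (_ + nat_of_bool _).
by apply: eq_has => y /=; rewrite -leqNgt.
Qed.

Lemma right_jumpE s i j : i < j < size s ->
  exists A x B C, [/\ B != [::], s = A ++ x :: B ++ C
                    & right_jump s i j = A ++ B ++ x :: C].
Proof.
case/andP=> lt_ij lt_js.
exists (take i s), (nth 0 s i), (take (j - i) (drop i.+1 s)), (drop j.+1 s).
split=> //.
  by rewrite -size_eq0 size_take size_drop; case: ifP => _; lia.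
have -> : drop j.+1 s = drop (j - i) (drop i.+1 s).
  by rewrite drop_drop; congr drop; lia.
by rewrite cat_take_drop -drop_nth ?cat_take_drop //; lia.
Qed.

Lemma right_jump_cat A x B C :
  right_jump (A ++ x :: B ++ C) (size A) (size A + size B) = A ++ B ++ x :: C.
Proof.
rewrite /right_jump take_size_cat // nth_cat ltnn subnn /= addnC addnK.
rewrite addnC -addnS !drop_cat !ltnNge leq_addr leqnSn /= addKn subSnn /= drop0.
by rewrite take_size_cat // drop_size_cat.
Qed.

(** Trades position arithmetic for a factorization of the word: one letter hops over the nonempty
    block after it. *)
Lemma mem_jumps s t :
  reflect (exists A x B C, [/\ B != [::], s = A ++ x :: B ++ C
                             & t = A ++ B ++ x :: C])
          (t \in jumps s).
Proof.
apply: (iffP allpairsPdep) => [[i [j [ + + ->]]]|[A [x [B [C [B0 -> ->]]]]]].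
  rewrite !mem_iota => /andP[_ lt_is] /andP[lt_ij lt_js].
  by apply: right_jumpE; rewrite lt_ij; rewrite subnKC in lt_js.
have sB : 0 < size B by rewrite lt0n size_eq0.
exists (size A), (size A + size B); rewrite right_jump_cat !mem_iota.
rewrite !size_cat /= size_cat add0n subnKC; last by rewrite addnS ltnS leq_addr.
by by rewrite ltn_add2l ltnS leq_addr !addnS !ltnS leq_addr -addn1 leq_add2l sB.
Qed.

(** Entries of [A] and [C] see the same running maximum before and after; those of [B] no longer see
    [x], so they can only become records. Only [x] itself can be demoted. *)
Lemma nonrecords_jump m s t :
  t \in jumps s -> nonrecords m t <= (nonrecords m s).+1.
Proof.
move=> /mem_jumps[A [x [B [C [_ -> ->]]]]].
rewrite !nonrecords_cat /= !nonrecords_cat.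
set mA := foldl maxn m A.
have leB : nonrecords mA B <= nonrecords (maxn mA x) B.
  by apply: nonrecords_mono; exact: leq_maxl.
have -> : foldl maxn (maxn mA x) B = maxn (foldl maxn mA B) x.
  by elim: (B) mA {leB} => //= y B' IHB mA; rewrite maxnAC IHB.
set c := nonrecords _ C; case: (x <= foldl _ _ _); lia.
Qed.

Lemma jumps_perm s t : t \in jumps s -> perm_eq t s.
Proof.
move=> /mem_jumps[A [x [B [C [_ -> ->]]]]].
by rewrite perm_cat2l -cat1s perm_catCA.
Qed.

(* Moving a non-record back to just before the first entry exceeding it turns
   it into a record and leaves the status of every other entry unchanged. *)
Lemma unjump s : uniq s -> all (leq 1) s -> 0 < nonrecords 0 s ->
  exists2 t, s \in jumps t & nonrecords 0 s = (nonrecords 0 t).+1.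
Proof.
move=> Us s_gt0 nr_gt0.
have [P [x [C [def_s has_P]]]]: exists P x C, s = P ++ x :: C /\ has (ltn x) P.
  elim/last_ind: s => // s z IHs in Us s_gt0 nr_gt0 *.
  move: Us s_gt0 nr_gt0; rewrite rcons_uniq all_rcons -cats1 nonrecords_cat /=.
  move=> /andP[z_s Us] /andP[z_gt0 s_gt0].
  case: (posnP (nonrecords 0 s)) => [-> | nr_s _]; last first.
    have [P [x [C [-> hP]]]] := IHs Us s_gt0 nr_s.
    by exists P, x, (C ++ [:: z]); rewrite -catA.
  rewrite leq_foldl_maxn [z <= 0]leqNgt z_gt0 /=; case hz: (has _ _) => // _.
  exists s, z, [::]; split=> //; apply/hasP; case/hasP: hz => y s_y le_zy.
  exists y => //=; rewrite ltn_neqAle [z <= y]le_zy andbT.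
  by apply: contraNneq z_s => ->.
have [i lt_iP] : exists2 i, i < size P & find (ltn x) P = i.
  by exists (find (ltn x) P) => //; rewrite -has_find.
move=> def_i; pose A := take i P; pose y := nth 0 P i; pose B := drop i.+1 P.
have defP : P = A ++ y :: B by rewrite -drop_nth ?cat_take_drop.
have lt_xy : x < y by rewrite /y -def_i; apply: (nth_find 0 has_P).
have leA : foldl maxn 0 A <= x.
  rewrite leqNgt -[_ < _]/(x.+1 <= _) leq_foldl_maxn ltn0 /=.
  apply/negP => /hasP[z /(nthP 0)[k]].
  rewrite size_take lt_iP => lt_ki <-; rewrite nth_take // => lt_xk.
  have := before_find (a := ltn x) (s := P) 0; rewrite def_i => /(_ _ lt_ki).
  by move/negP; apply.
(* Equality would force [x = 0] or an occurrence of [x] in [A], against positivity and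
   distinctness. *)
have ltA : foldl maxn 0 A < x.
  rewrite ltn_neqAle leA andbT; apply/negP => /eqP def_x.
  have := leqnn x; rewrite -{2}def_x leq_foldl_maxn; case/orP => [|/hasP[z Az le_xz]].
    move: s_gt0; rewrite def_s all_cat /= => /and3P[_ x_gt0 _].
    by rewrite leqNgt x_gt0.
  have le_zx : z <= x.
    by rewrite -def_x leq_foldl_maxn; apply/orP; right; apply/hasP; exists z.
  have zx : z = x by apply/eqP; rewrite eqn_leq le_zx.
  move: Us; rewrite def_s cat_uniq /= defP !mem_cat -zx Az /=.
  by rewrite andbF.
exists (A ++ x :: (y :: B) ++ C).
  by apply/mem_jumps; exists A, x, (y :: B), C; rewrite def_s defP -catA.
rewrite def_s defP -catA !nonrecords_cat /= !nonrecords_cat /=.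
set mA := foldl maxn 0 A in leA ltA *.
(* The larger [y] absorbs [x] in the running maximum, so [B] and [C] do not notice the move. *)
have -> : maxn (maxn mA x) y = maxn mA y by lia.
have x_B : x <= foldl maxn (maxn mA y) B by rewrite leq_foldl_maxn; lia.
rewrite (maxn_idPl x_B) x_B [x <= mA]leqNgt ltA [y <= maxn _ _]leqNgt.
rewrite [y <= mA]leqNgt; lia.
Qed.

Lemma nonrecords_path m s : nonrecords m s = 0 <-> path ltn m s.
Proof.
elim: s m => //= x s IHs m; rewrite [x <= m]leqNgt; case: ltnP => //= lt_mx.
by rewrite add0n; apply: IHs.
Qed.

Lemma reach_nonrecords_le n k s : reach n k s -> nonrecords 0 s <= k.
Proof.
elim: k s => [|k IHk] s.
  rewrite /reach inE => /eqP->; rewrite leqn0; apply/eqP/nonrecords_path.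
  (* By computation, sortedness of [iota 0 n.+1] is a path from 0 through [iota 1 n]. *)
  exact: (iota_ltn_sorted 0 n.+1).
by case/flatten_mapP => t /IHk le_tk /nonrecords_jump-/(_ 0)/leq_trans; apply.
Qed.

Lemma perm_iota1_gt0 n s : perm_eq s (iota 1 n) -> all (leq 1) s.
Proof.
move/perm_all->; apply/allP => i; rewrite mem_iota; by case/andP.
Qed.

(** Induction on the number of non-records, each undone jump removing one. A word without
    non-records is increasing, hence the identity. *)
Lemma reach_nonrecords n s :
  perm_eq s (iota 1 n) -> reach n (nonrecords 0 s) s.
Proof.
move Dk: (nonrecords 0 s) => k; elim: k s Dk => [|k IHk] s Dk Ps.
  rewrite /reach inE; apply/eqP.
  apply: (irr_sorted_eq ltn_trans ltnn _ (iota_ltn_sorted 1 n) (perm_mem Ps)).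
  by move/nonrecords_path: Dk => /path_sorted.
have Us : uniq s by rewrite (perm_uniq Ps) iota_uniq.
have [|t st] := unjump Us (perm_iota1_gt0 Ps); first by rewrite Dk.
rewrite Dk => -[Dt].
apply/flatten_mapP; exists t => //; apply: IHk => //.
by apply: perm_trans Ps; rewrite perm_sym; apply: jumps_perm.
Qed.

Lemma dist_eq_nlrmax n p s :
  perm_eq s (iota 1 n) -> dist_eq n p s = (nlrmax s == p).
Proof.
move=> Ps; rewrite nlrmaxE ?(perm_iota1_gt0 Ps) //.
apply/andP/eqP => [[rp /allP min_p] | <-].
  apply/eqP; rewrite eqn_leq (reach_nonrecords_le rp) leqNgt.
  apply/negP => lt_sp; have := min_p (nonrecords 0 s).
  by rewrite mem_iota lt_sp reach_nonrecords // => /(_ isT).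
split; first exact: reach_nonrecords.
apply/allP => q; rewrite mem_iota => /andP[_ lt_q]; apply/negP.
by move/reach_nonrecords_le; rewrite leqNgt lt_q.
Qed.

(** * The common recurrence *)

(* [stirling_diag n p] is the unsigned Stirling number c(n, n - p). *)
Fixpoint stirling_diag (n p : nat) : nat :=
  if n is n'.+1 then
    stirling_diag n' p + (if p is p'.+1 then n' * stirling_diag n' p' else 0)
  else (p == 0).

Lemma stirling_diag_gt n p : n < p -> stirling_diag n p = 0.
Proof.
elim: n p => [|n IHn] [|p] //= lt_np.
by rewrite !IHn ?muln0 //; lia.
Qed.

(** * Insertion of the smallest letter *)

Definition insert (x i : nat) (s : seq nat) := take i s ++ x :: drop i s.

Lemma perm_insert x i s : perm_eq (insert x i s) (x :: s).
Proof. by rewrite /insert -cat1s perm_catCA /= cat_take_drop. Qed.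

(** Together with [rem_insert], recovers position and word from an insertion; this yields the
    injectivity in [permutations_cons]. *)
Lemma index_insert x i s : x \notin s -> i <= size s -> index x (insert x i s) = i.
Proof.
move=> x_s le_is; have x_ti : x \notin take i s by apply: contra x_s => /mem_take.
by rewrite /insert index_cat (negPf x_ti) /= eqxx addn0 size_takel.
Qed.

Lemma rem_insert x i s : x \notin s -> i <= size s -> rem x (insert x i s) = s.
Proof.
move=> x_s le_is; rewrite remE index_insert // /insert.
rewrite take_size_cat ?size_takel // drop_cat size_takel // ltnNge leqnSn /=.
by rewrite subSnn /= drop0 cat_take_drop.
Qed.

Lemma permutations_cons x s : x \notin s ->
  perm_eq (permutations (x :: s))
    [seq insert x i t | t <- permutations s, i <- iota 0 (size s).+1].
Proof.
move=> x_s; apply/uniq_perm; first exact: permutations_uniq.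
  apply: allpairs_uniq; rewrite ?permutations_uniq ?iota_uniq //.
  move=> v w /allpairsP v_in /allpairsP w_in.
  case: v_in w_in => -[t i] [/= Pt Hi ->{v}] [[u j] [/= Pu Hj ->{w}]] /= E.
  rewrite !mem_permutations in Pt Pu; rewrite -/(iota 0 (size s).+1) !mem_iota in Hi Hj.
  have x_t : x \notin t by rewrite (perm_mem Pt).
  have x_u : x \notin u by rewrite (perm_mem Pu).
  rewrite -(perm_size Pt) in Hi; rewrite -(perm_size Pu) in Hj.
  congr pair; first by rewrite -(rem_insert x_t Hi) E rem_insert.
  by rewrite -(index_insert x_t Hi) E index_insert.
move=> t; rewrite mem_permutations; apply/idP/allpairsP => [Pt|[[u i] [/= Pu _ ->]]].
  have x_t : x \in t by rewrite (perm_mem Pt) mem_head.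
  exists (rem x t, index x t); split.
  - rewrite mem_permutations -(perm_cons x) perm_sym /=.
    by rewrite -(permPl Pt) perm_to_rem.
  - by rewrite mem_iota add0n -[(size s).+1]/(size (x :: s)) -(perm_size Pt) index_mem.
  rewrite /insert /= remE; set i := index x t.
  rewrite take_size_cat ?size_takel ?index_size // drop_size_cat ?size_takel ?index_size //.
  by rewrite -[X in X :: _](nth_index x x_t) -drop_nth ?index_mem // cat_take_drop.
rewrite mem_permutations in Pu.
by rewrite (permPl (perm_insert x i u)) perm_cons.
Qed.

(** A letter below all others never changes their status, and is itself a record only in front. *)
Lemma nonrecords_insert_min x i s : 0 < x -> all (ltn x) s -> i <= size s ->
  nonrecords 0 (insert x i s) = nonrecords 0 s + (0 < i).
Proof.
move=> x_gt0 gt_x le_is; case: i le_is => [|i] le_is.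
  rewrite /insert take0 drop0 /= [x <= 0]leqNgt x_gt0 max0n addn0.
  case: s gt_x {le_is} => //= y s /andP[lt_xy _].
  rewrite [y <= x]leqNgt lt_xy [y <= 0]leqNgt (leq_ltn_trans _ lt_xy) //.
  by rewrite max0n (maxn_idPr (ltnW lt_xy)).
rewrite -{2}(cat_take_drop i.+1 s) /insert !nonrecords_cat /=.
have lt_xm : x < foldl maxn 0 (take i.+1 s).
  case: s gt_x le_is => //= y s /andP[lt_xy _] _.
  by rewrite -[_ < _]/(x.+1 <= _) leq_foldl_maxn max0n lt_xy.
by rewrite (ltnW lt_xm) (maxn_idPl (ltnW lt_xm)) addnCA addnC.
Qed.

(** Stated for any increasing list of positive letters, because removing the smallest letter of
    [iota 1 n] leaves the form [iota 1 _]. Of the possible insertion positions, the front one keeps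
    the count and the [size L] others raise it by one. *)
Lemma count_nonrecords L p : path ltn 0 L ->
  count (fun s => nonrecords 0 s == p) (permutations L)
  = stirling_diag (size L) p.
Proof.
elim: L p => [|x L IHL] p; first by rewrite /= eq_sym addn0.
move=> /= /andP[x_gt0 lt_xL].
have ltxL : all (ltn x) L by apply: order_path_min lt_xL; apply: ltn_trans.
have pathL : path ltn 0 L.
  by case: (L) lt_xL => //= y s /andP[lt_xy ->]; rewrite (ltn_trans x_gt0).
have x_L : x \notin L by apply/negP => /(allP ltxL) /=; rewrite ltnn.
rewrite (seq.permP (permutations_cons x_L)) count_flatten -map_comp sumnE big_map.
transitivity (\sum_(t <- permutations L)
   ((nonrecords 0 t == p) + size L * ((nonrecords 0 t).+1 == p))).
  apply: eq_big_seq => t; rewrite mem_permutations => Pt.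
  rewrite /= count_map /= nonrecords_insert_min ?(perm_all _ Pt) // addn0.
  congr (_ + _).
  rewrite (eq_in_count (a2 := fun=> (nonrecords 0 t).+1 == p)) => [|i].
    by case: eqP => _; rewrite ?count_predT ?count_pred0 ?size_iota ?muln1 ?muln0.
  rewrite mem_iota => /andP[i_gt0 lt_i] /=.
  rewrite nonrecords_insert_min ?(perm_all _ Pt) // ?(perm_size Pt) //.
  by rewrite i_gt0 addn1.
rewrite big_split /= -big_distrr /=.
have cntE (P : pred (seq nat)) s : \sum_(t <- s) P t = count P s.
  by rewrite -sum1_count [RHS]big_mkcond; apply: eq_bigr => t _; case: (P t).
rewrite (cntE (fun t => nonrecords 0 t == p)) (cntE (fun t => (nonrecords 0 t).+1 == p)).
rewrite IHL //; congr (_ + _).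
case: p => [|p]; first by rewrite (eq_count (a2 := pred0)) // count_pred0 muln0.
by rewrite -(IHL p pathL); congr (_ * _); apply: eq_count => t; rewrite eqSS.
Qed.

Lemma dnp_stirling_diag n p : dnp n p = stirling_diag n p.
Proof.
transitivity (count (fun s => nonrecords 0 s == p) (permutations (iota 1 n))).
  2: by rewrite count_nonrecords ?size_iota //; apply: (iota_ltn_sorted 0 n.+1).
apply: eq_in_count => s; rewrite mem_permutations => Ps.
by rewrite dist_eq_nlrmax // nlrmaxE // (perm_iota1_gt0 Ps).
Qed.

(** * Cycles of permutations *)

Section Cycles.
Local Open Scope group_scope.

Lemma lift_permX_id n (i : 'I_n.+1) (s : 'S_n) k : (lift_perm i i s ^+ k) i = i.
Proof.
elim: k => [|k IHk]; first by rewrite expg0 perm1.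
by rewrite expgSr permM IHk lift_perm_id.
Qed.

Lemma lift_permX_lift n (i : 'I_n.+1) (s : 'S_n) k x :
  (lift_perm i i s ^+ k) (lift i x) = lift i ((s ^+ k) x).
Proof.
elim: k => [|k IHk]; first by rewrite !expg0 !perm1.
by rewrite !expgSr !permM IHk lift_perm_lift.
Qed.

Lemma porbit_lift_perm_id n (i : 'I_n.+1) (s : 'S_n) :
  porbit (lift_perm i i s) i = [set i].
Proof.
apply/setP => y; rewrite inE; apply/porbitP/eqP => [[k ->]|->].
  exact: lift_permX_id.
by exists 0; rewrite lift_permX_id.
Qed.

Lemma porbit_lift_perm_lift n (i : 'I_n.+1) (s : 'S_n) x :
  porbit (lift_perm i i s) (lift i x) = lift i @: porbit s x.
Proof.
apply/setP => y; apply/porbitP/imsetP => [[k ->]|[z /porbitP[k ->] ->]].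
  by exists ((s ^+ k) x); rewrite ?mem_porbit ?lift_permX_lift.
by exists k; rewrite lift_permX_lift.
Qed.

(** The lifted permutation fixes [i] and copies [s] elsewhere: its cycles are the singleton of [i]
    and the lifted cycles of [s]. *)
Lemma card_porbits_lift_perm n (i : 'I_n.+1) (s : 'S_n) :
  #|porbits (lift_perm i i s)| = #|porbits s|.+1.
Proof.
have -> : porbits (lift_perm i i s)
    = [set i] |: (fun A : {set 'I_n} => lift i @: A) @: porbits s.
  apply/setP => A; rewrite !inE; apply/imsetP/orP => [[y _ ->]|].
    case: (unliftP i y) => [x ->|->]; [right | left]; last first.
      by rewrite porbit_lift_perm_id.
    rewrite porbit_lift_perm_lift; apply: imset_f; exact: imset_f.
  case=> [/eqP-> | /imsetP[_ /imsetP[x _ ->] ->]].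
    by exists i; rewrite ?porbit_lift_perm_id.
  by exists (lift i x); rewrite ?porbit_lift_perm_lift.
rewrite cardsU1 card_imset; last exact/imset_inj/lift_inj.
suff -> : [set i] \notin (fun A : {set 'I_n} => lift i @: A) @: porbits s by [].
apply/negP => /imsetP[B _ /setP/(_ i)]; rewrite !inE eqxx => /esym/imsetP[x _].
by move/eqP; rewrite (negPf (neq_lift _ _)).
Qed.

(** A proper transposition merges the new fixed point into another cycle, cancelling the extra one;
    for [i = ord_max] it is trivial. *)
Lemma card_porbits_tperm_lift n (i : 'I_n.+1) (s : 'S_n) :
  #|porbits (tperm ord_max i * lift_perm ord_max ord_max s)|
  = #|porbits s| + (i == ord_max).
Proof.
have := porbits_mul_tperm (lift_perm ord_max ord_max s) i ord_max => /=.
rewrite card_porbits_lift_perm porbit_lift_perm_id inE tpermC.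
by case: eqVneq => _ /=; lia.
Qed.

Lemma stirling1_rec n k :
  stirling1 n.+1 k
  = (if k is k'.+1 then stirling1 n k' else 0) + n * stirling1 n k.
Proof.
(* Products act from left to right, so [u.1] is the preimage of [ord_max] under [h u]; hence
   injectivity, and bijectivity by cardinality. *)
pose h (u : 'I_n.+1 * 'S_n) : 'S_n.+1 :=
  tperm ord_max u.1 * lift_perm ord_max ord_max u.2.
have h_inj : injective h.
  move=> [i s] [j t]; rewrite /h /= => E.
  have hi : h (i, s) i = ord_max by rewrite permM tpermR lift_perm_id.
  have hj : h (j, t) j = ord_max by rewrite permM tpermR lift_perm_id.
  have eq_ij : i = j.
    by apply: (@perm_inj _ (h (i, s))); rewrite hi /h /= E -/(h (j, t)) hj.
  rewrite eq_ij in E *; move/mulgI: E => /permP E; congr pair.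
  apply/permP => x; have := E (lift ord_max x).
  by rewrite !lift_perm_lift => /lift_inj.
have h_bij : bijective h.
  apply: inj_card_bij => //.
  by rewrite card_prod !card_Sn card_ord factS.
have sumE m l : stirling1 m l = \sum_(s : 'S_m) (#|porbits s| == l).
  by rewrite /stirling1 -sum1dep_card [LHS]big_mkcond; apply: eq_bigr => s _; case: eqP.
rewrite [LHS]sumE (reindex h) /=; last exact: onW_bij.
rewrite -(pair_bigA _ (fun i s => (#|porbits (h (i, s))| == k) : nat)) /=.
rewrite (bigD1 ord_max) //=; congr (_ + _).
  under eq_bigr => s _ do rewrite card_porbits_tperm_lift eqxx addn1.
  case: k => [|k]; first by rewrite big1.
  by rewrite sumE; apply: eq_bigr => s _; rewrite eqSS.
rewrite (eq_bigr (fun=> stirling1 n k)) => [|i ne_i].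
  by rewrite sum_nat_const cardC1 card_ord.
rewrite sumE; apply: eq_bigr => s _.
by rewrite card_porbits_tperm_lift (negPf ne_i) addn0.
Qed.
End Cycles.

Lemma card_porbits_le n (s : 'S_n) : #|porbits s| <= n.
Proof. by apply: leq_trans (leq_imset_card _ _) _; rewrite card_ord. Qed.

Lemma stirling1_gt n k : n < k -> stirling1 n k = 0.
Proof.
move=> lt_nk; apply/eqP; rewrite cards_eq0 -subset0; apply/subsetP => s.
by rewrite !inE => /eqP def_k; have := card_porbits_le s; rewrite def_k leqNgt lt_nk.
Qed.

Lemma stirling1_0 k : stirling1 0 k = (k == 0).
Proof.
case: k => [|k]; last exact: stirling1_gt.
rewrite -[RHS]/(0`!) -card_Sn; apply: eq_card => s.
by rewrite !inE -leqn0 card_porbits_le.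
Qed.

Lemma stirling1_diag n p : p <= n -> stirling1 n (n - p) = stirling_diag n p.
Proof.
elim: n p => [|n IHn] p le_pn.
  by rewrite stirling1_0 sub0n; case: p le_pn.
rewrite stirling1_rec /=; case: p le_pn => [|p] le_pn.
  by rewrite subn0 -(IHn 0) // subn0 (@stirling1_gt n n.+1) // muln0.
rewrite subSS IHn //; congr (_ + _).
case: (ltnP p n) => [lt_pn | le_np]; first by rewrite -subnSK //= IHn.
(* [le_np] unfolds to [n - p == 0], so the match reduces to 0. *)
by rewrite (eqP le_np) stirling_diag_gt.
Qed.

(** * Interpolation of the Stirling diagonal *)

Lemma stirling_diag0 n : stirling_diag n 0 = 1.
Proof. by elim: n => //= n ->. Qed.

(** Supplies the roots -1, ..., -p of the interpolated polynomial. *)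
Lemma stirling_diag_ge n p : 0 < p -> n <= p -> stirling_diag n p = 0.
Proof.
elim: n p => [|n IHn] [|p] //= _; rewrite ltnS => le_np.
rewrite IHn ?(leqW le_np) //.
by case: n IHn le_np => // n IHn lt_np; rewrite IHn ?muln0 // (leq_trans _ lt_np).
Qed.

Section Interpolation.
Import Order.TTheory GRing.Theory Num.Theory.
Local Open Scope ring_scope.

(** * Surjection numbers *)

Section Surjections.
Variable R : comPzRingType.

(* The number of surjections from an [e]-set onto an [h]-set, by inclusion-exclusion. *)
Definition surj (h e : nat) : R :=
  \sum_(j < h.+1) (-1) ^+ j * 'C(h, j)%:R * (h%:R - j%:R) ^+ e.

Lemma surj0e e : surj 0 e = (e == 0)%:R.
Proof. by rewrite /surj big_ord1 bin0 subrr expr0n !mul1r. Qed.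

Lemma surjh0 h : surj h 0 = (h == 0)%:R.
Proof.
rewrite -expr0n -[0 in RHS](subrr 1) exprDn.
by apply: eq_bigr => j _; rewrite expr0 mulr1 expr1n mul1r mulr_natr.
Qed.

(** Combinatorially: choose the image of the last element; the rest covers all values, or all but
    that one. Algebraically: a factor h + 1 - j is absorbed into the binomial coefficient, then
    Pascal's rule applies. *)
Lemma surjS h e : surj h.+1 e.+1 = h.+1%:R * (surj h.+1 e + surj h e).
Proof.
transitivity (h.+1%:R * \sum_(j < h.+1)
    (-1) ^+ j * 'C(h, j)%:R * (h.+1%:R - j%:R) ^+ e : R).
  rewrite /surj big_ord_recr /= subrr expr0n mulr0 addr0 big_distrr /=.
  apply: eq_bigr => j _; have := mul_bin_down h.+1 j => /= /(congr1 (fun k => k%:R : R)).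
  rewrite !natrM natrB ?(ltnW (ltn_ord j)) // => binE.
  transitivity ((-1) ^+ j * (h.+1%:R - j%:R) ^+ e * (h.+1%:R * 'C(h, j)%:R) : R).
    by rewrite binE exprS; ring.
  by ring.
congr (_ * _); rewrite /surj [in X in _ = X + _]big_ord_recl [LHS]big_ord_recl /=.
rewrite !bin0 -addrA; congr (_ + _); rewrite -big_split /=.
rewrite [RHS]big_ord_recr /= [X in _ = _ + X](_ : _ = 0) ?addr0; last first.
  by rewrite /bump leq0n add1n !binn !subrr exprS; ring.
apply: eq_bigr => j _; rewrite /bump leq0n add1n binS natrD exprS /=.
have -> : h.+1%:R - j.+1%:R = h%:R - j%:R :> R by ring.
by ring.
Qed.

Lemma surj_lt h e : (e < h)%N -> surj h e = 0.
Proof.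
elim: e h => [|e IHe] [|h] // lt_eh; first by rewrite surjh0.
by rewrite surjS !IHe ?addr0 ?mulr0 // ltnW.
Qed.

Lemma surjhh h : surj h h = h`!%:R.
Proof.
elim: h => [|h IHh]; first by rewrite surj0e.
by rewrite surjS surj_lt // add0r IHh factS natrM.
Qed.

End Surjections.

(** * Rising factorials and antidifferences *)

Section RisingFactorial.
Variable R : comNzRingType.

Definition rising (d : nat) : {poly R} := \prod_(i < d) ('X + i%:R%:P).

Lemma risingS d : rising d.+1 = rising d * ('X + d%:R%:P).
Proof. exact: big_ord_recr. Qed.

Lemma rising_monic d : rising d \is monic.
Proof. by apply: monic_prod => i _; rewrite monicXaddC. Qed.

Lemma size_rising d : size (rising d) = d.+1.
Proof.
elim: d => [|d IHd]; first by rewrite /rising big_ord0 size_poly1.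
by rewrite risingS size_Mmonic ?monicXaddC -?size_poly_eq0 ?IHd // size_XaddC addn2.
Qed.

(** The backward-difference analogue of the derivative of a power: both values share the factor
    [rising d]. *)
Lemma rising_diff d x :
  (rising d.+1).[x] - (rising d.+1).[x - 1] = d.+1%:R * (rising d).[x].
Proof.
have shift : (rising d.+1).[x - 1] = (x - 1) * (rising d).[x].
  elim: d => [|d IHd]; rewrite [in LHS]risingS hornerM.
    by rewrite /rising big_ord0 !hornerE; ring.
  by rewrite IHd [in RHS]risingS hornerM !(hornerD, hornerX, hornerC); ring.
by rewrite shift risingS hornerM !(hornerD, hornerX, hornerC); ring.
Qed.

Lemma rising0 d : (rising d.+1).[0] = 0.
Proof. by rewrite /rising big_ord_recl !hornerE. Qed.

End RisingFactorial.

(** Discrete integration: peel off the top coefficient along [rising R d] and integrate that term by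
    [rising_diff]. *)
Lemma poly_antidifference (R : numFieldType) d (q : {poly R}) : (size q <= d)%N ->
  exists Q : {poly R}, [/\ (size Q <= d.+1)%N, Q.[0] = 0
                         & forall x, Q.[x] - Q.[x - 1] = q.[x]].
Proof.
elim: d q => [|d IHd] q sz_q.
  exists 0; split; rewrite ?size_poly0 ?horner0 // => x.
  by move/size_poly_leq0P: sz_q => ->; rewrite !horner0 subrr.
have [|Q [sz_Q Q0 dQ]] := IHd (q - q`_d *: rising R d).
  apply/leq_sizeP => j; rewrite leq_eqVlt coefB coefZ => /orP[/eqP<-|lt_dj].
    have /monicP := rising_monic R d; rewrite lead_coefE size_rising /= => ->.
    by rewrite mulr1 subrr.
  rewrite [q`_j]nth_default ?(leq_trans sz_q lt_dj) //.
  by rewrite [_`_j]nth_default ?size_rising // mulr0 subrr.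
exists (Q + (q`_d / d.+1%:R) *: rising R d.+1); split=> [||x].
- rewrite (leq_trans (size_polyD _ _)) // geq_max (leqW sz_Q).
  by rewrite (leq_trans (size_scale_leq _ _)) ?size_rising.
- by rewrite hornerD hornerZ Q0 rising0 mulr0 addr0.
have -> : q.[x] = (Q.[x] - Q.[x - 1]) + q`_d * (rising R d).[x].
  by rewrite dQ hornerD hornerN hornerZ subrK.
have := rising_diff d x => /(canRL (subrK _)) dr.
rewrite !hornerD !hornerZ dr; field.
by rewrite addrC natr1 pnatr_eq0.
Qed.

(* Both diagonals c(n, n - p) and S(p + h, h) are values of one polynomial of
   degree at most 2p, at -n and at h: they obey the same difference equation. *)
Lemma stirling_poly (R : numFieldType) p : exists F : {poly R},
  [/\ (size F <= p.*2.+1)%N,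
      forall n, F.[- n%:R] = (stirling_diag n p)%:R
    & forall h, F.[h%:R] = surj R h (p + h) / h`!%:R].
Proof.
elim: p => [|p [F [sz_F Fneg Fpos]]].
  exists 1; split=> [|n|h]; rewrite ?size_poly1 // hornerE.
    by rewrite stirling_diag0.
  by rewrite surjhh divff // pnatr_eq0 -lt0n fact_gt0.
(* Multiplication by X and summation each raise the degree bound by one, from 2p to 2(p + 1). *)
have [|Q [sz_Q Q0 dQ]] := @poly_antidifference R p.*2.+2 (F * 'X).
  case: (eqVneq F 0) => [->|F0]; first by rewrite mul0r size_poly0.
  by rewrite size_mulX.
(* At x = -n this is the recurrence for c(n + 1, n - p), at x = h + 1 the one for S(p + h + 2, h +
   1). *)
have QE x : Q.[x] = Q.[x - 1] + F.[x] * x.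
  by rewrite -[in LHS](subrK Q.[x - 1] Q.[x]) dQ hornerMX addrC.
exists Q; split=> //.
- elim=> [|n IHn]; first by rewrite oppr0 Q0.
  have := QE (- n%:R); rewrite IHn Fneg -opprD natr1 => /(canLR (addrK _)) <-.
  by rewrite /= natrD natrM mulrN opprK mulrC.
elim=> [|h IHh]; first by rewrite Q0 surj0e mul0r.
rewrite QE -[in X in X - 1]natr1 addrK IHh Fpos factS natrM.
have -> : surj R h.+1 (p.+1 + h.+1)
    = h.+1%:R * (surj R h.+1 (p + h.+1) + surj R h (p.+1 + h)).
  by rewrite [in LHS]addSn surjS addSnnS.
have h1 : h.+1%:R != 0 :> R by rewrite pnatr_eq0.
have hf : h`!%:R != 0 :> R by rewrite pnatr_eq0 -lt0n fact_gt0.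
rewrite -natr1 in h1 *; field; exact/andP.
Qed.

(** * Lagrange interpolation at -p, ..., p *)

Lemma lagrange_horner (K : fieldType) (x : nat -> K) n (F : {poly K}) y :
  (0 < n)%N -> injective x -> (size F <= n)%N ->
  F.[y] = \sum_(i < n) F.[x i] * \prod_(j < n | j != i) ((y - x j) / (x i - x j)).
Proof.
move=> n_gt0 x_inj sz_F.
rewrite [F in LHS](lagrange_gen n_gt0 x_inj sz_F) horner_sum.
apply: eq_bigr => i _; rewrite hornerM hornerC lagrangeE // hornerM hornerC.
congr (_ * _); rewrite big_split /= prodfV mulrC !horner_prod.
by congr (_ * _^-1); apply: eq_bigr => j _; rewrite hornerXsubC.
Qed.

(** Nodes below [i] contribute [i!], those above contribute [k!] with sign (-1)^k. *)
Lemma prod_node_differences (R : comPzRingType) i k :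
  \prod_(j < (i + k).+1 | j != i :> nat) (i%:R - j%:R) = (-1) ^+ k * i`!%:R * k`!%:R :> R.
Proof.
elim: k => [|k IHk]; rewrite big_mkcond big_ord_recr /=.
  rewrite addn0 eqxx mulr1 mul1r fact0 mulr1 -ffactnn ffact_prod natr_prod.
  by apply: eq_bigr => j _; rewrite neq_ltn ltn_ord natrB // ltnW.
rewrite addnS -big_mkcond IHk neq_ltn (ltnS i) leq_addr orbT factS.
by rewrite exprS -addnS natrD natrM; ring.
Qed.

Lemma prod_rising_fact a m : (a`! * \prod_(j < m) (a.+1 + j) = (a + m)`!)%N.
Proof.
elim: m => [|m IHm]; first by rewrite big_ord0 muln1 addn0.
by rewrite big_ord_recr /= mulnA IHm mulnC addnS factS.
Qed.

(** The full product is (a + 2p + 1)! / a!; the omitted factor a + p + h + 1 turns (a + p + h + 1)!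
    into (a + p + h)!, which the two binomials encode. *)
Lemma binomial_node_prod a p h : (h <= p)%N ->
  (\prod_(j < p.*2.+1 | j != (p + h)%N :> nat) (a.+1 + j)
   = 'C(a + p + h, p + h) * 'C(a + p.*2.+1, p - h) * ((p + h)`! * (p - h)`!))%N.
Proof.
move=> le_hp.
have lt_i : (p + h < p.*2.+1)%N by rewrite ltnS -addnn leq_add2l.
apply/eqP; rewrite -(eqn_pmul2l (fact_gt0 (a + p + h).+1)) -(eqn_pmul2l (fact_gt0 a)).
apply/eqP.
have E1 := prod_rising_fact a p.*2.+1.
rewrite (bigD1 (Ordinal lt_i)) //= in E1.
have E2 := bin_fact (leq_addl a (p + h)); rewrite addnK addnA in E2.
have le3 : (p - h <= a + p.*2.+1)%N by lia.
have E3 := bin_fact le3.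
have e4 : (a + p.*2.+1 - (p - h) = (a + p + h).+1)%N by lia.
rewrite e4 in E3.
set P := (\prod_(_ < _ | _) _)%N in E1 *.
transitivity ((a + p + h)`! * (a`! * ((a.+1 + (p + h)) * P)))%N.
  by rewrite factS addSn addnA; ring.
by rewrite E1 -E2 -E3; ring.
Qed.

(** The weight of the node h, which has index p + h among the nodes j - p, evaluated at -n with n =
    a + p + 1. The 2p signs of the numerators cancel; the denominators leave (-1)^(p - h), which
    equals (-1)^(p + h). *)
Lemma lagrange_weight (R : numFieldType) a p h : (h <= p)%N ->
  \prod_(j < p.*2.+1 | j != (p + h)%N :> nat)
     ((- (a + p).+1%:R - (j%:R - p%:R)) / ((p + h)%:R - p%:R - (j%:R - p%:R)))
  = (-1) ^+ (p + h) * 'C(a + p + h, p + h)%:R * 'C(a + p.*2.+1, p - h)%:R :> R.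
Proof.
move=> le_hp; have def_2p : p.*2 = (p + h + (p - h))%N by lia.
have lt_i : (p + h < p.*2.+1)%N by rewrite ltnS -addnn leq_add2l.
rewrite big_split /= prodfV.
rewrite (eq_bigr (fun j : 'I__ => - (a.+1 + j)%:R)) => [|j _]; last first.
  by rewrite -addSn !natrD; ring.
rewrite prodrN -natr_prod binomial_node_prod //.
rewrite (eq_card (B := predC1 (Ordinal lt_i))) // cardC1 card_ord /=.
rewrite (eq_bigr (fun j : 'I__ => (p + h)%:R - j%:R)) => [|j _]; last by ring.
have -> : \prod_(j < p.*2.+1 | j != (p + h)%N :> nat) ((p + h)%:R - j%:R)
    = (-1) ^+ (p - h) * (p + h)`!%:R * (p - h)`!%:R :> R.
  by rewrite def_2p prod_node_differences.
have f1 : (p + h)`!%:R != 0 :> R by rewrite pnatr_eq0 -lt0n fact_gt0.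
have f2 : (p - h)`!%:R != 0 :> R by rewrite pnatr_eq0 -lt0n fact_gt0.
rewrite {1}def_2p exprD !natrM.
by field; rewrite f1 f2 signr_eq0.
Qed.

Lemma stirling_diag_formula n p : (p < n)%N ->
  (stirling_diag n p)%:R = dnp_formula n p.
Proof.
move=> lt_pn; have [F [sz_F Fneg Fpos]] := stirling_poly rat p.
pose x i : rat := i%:R - p%:R.
have x_inj : injective x by move=> i j /addIr/eqP; rewrite eqr_nat => /eqP.
have [a def_n] : exists a, n = (a + p).+1 by exists (n - p.+1)%N; lia.
rewrite -Fneg (@lagrange_horner _ x p.*2.+1) //.
(* Indexing by naturals lets the sum be split at [p], that is, at the node 0. *)
rewrite -(big_mkord xpredT (fun i => F.[x i] *
   \prod_(j < p.*2.+1 | j != i :> nat) ((- n%:R - x j) / (x i - x j)))).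
rewrite (@big_cat_nat _ _ _ p) //=; last by lia.
(* For [i < p] the node is -(p - i) with 1 <= p - i <= p, and F vanishes there; such an [i] forces p
   > 0. *)
rewrite big_nat_cond big1 ?add0r => [|i /andP[/andP[_ lt_ip] _]]; last first.
  have -> : x i = - (p - i)%:R by rewrite natrB ?opprB // ltnW.
  by rewrite Fneg stirling_diag_ge ?mul0r ?leq_subr //; lia.
rewrite -{1}[p]add0n big_addn (_ : p.*2.+1 - p = p.+1)%N; last by lia.
rewrite big_mkord /dnp_formula; apply: eq_bigr => h _.
have le_hp : (h <= p)%N by rewrite -ltnS.
have -> : x (h + p)%N = h%:R by rewrite /x natrD addrK.
rewrite Fpos {1}def_n.
rewrite (eq_bigr (fun j : 'I_p.*2.+1 =>
   (- (a + p).+1%:R - (j%:R - p%:R)) / ((p + h)%:R - p%:R - (j%:R - p%:R)))); last first.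
  by move=> j _; rewrite /x [(p + h)%:R]natrD [_ + h%:R]addrC addrK.
under eq_bigl => j do rewrite addnC.
rewrite lagrange_weight // /surj 2!mulr_suml; apply: eq_bigr => j _.
rewrite def_n /= (_ : (a + p).+1 + p = a + p.*2.+1)%N; last by lia.
(* Reversing the difference absorbs the sign (-1)^(p + h) of the weight. *)
have -> : (j%:Z - h%:Z)%:~R = - (h%:R - j%:R) :> rat by rewrite opprB rmorphB.
by rewrite [(- (_ - _)) ^+ _]exprNn; ring.
Qed.

End Interpolation.

Theorem mainTheorem2 (n p : nat) (hn : (1 <= n)%N) (hp : (p <= n.-1)%N) :
  (forall s : seq nat, perm_eq s (iota 1 n) -> dist_eq n p s = (nlrmax s == p))
  /\ dnp n p = stirling1 n (n - p)
  /\ ((dnp n p)%:R : rat) = dnp_formula n p.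
Proof.
have lt_pn : (p < n)%N by rewrite -(prednK hn) ltnS.
rewrite dnp_stirling_diag stirling1_diag ?(ltnW lt_pn) //.
split; first exact: dist_eq_nlrmax.
by split; last exact: stirling_diag_formula.
Qed.
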